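(* Let $F$ be a field of characteristic zero, $G$ a finite group, and let $A$ be a unitary $(G,* )$-algebra over $F$ with quadratic codimension growth and of type $F+J(A)$. For $g,h\in G$ with $h\neq1$: (1) $m_{((1)_{1^+},(1)_{h^+})}\neq0$ if and only if $U_{3,*}^h\in\mathrm{var}^\sharp(A)$. (2) $m_{((1)_{1^+},(1)_{g^-})}\neq0$ if and only if $N_{3,*}^g\in\mathrm{var}^\sharp(A)$.
   Context: A $(G,* )$-algebra is an associative $G$-graded $F$-algebra $A=\bigoplus_{g\in G}A_g$ with an ($F$-linear) involution $*$ such that $A_g^*=A_g$; put $A_g^{\pm}=\{a\in A_g:a^*=\pm a\}$. Unitary means having a unit element; type $F+J(A)$ means $A=F\cdot 1+J(A)$ with $J(A)$ the Jacobson radical. The free $(G,* )$-algebra is the free associative algebra on variables $x_{i,g}^+$ (symmetric of degree $g$) and $x_{i,g}^-$ (skew of degree $g$), $i\ge1$, $g\in G$. $\mathrm{Id}^\sharp(A)$ is the set of its elements vanishing under all evaluations $x_{i,g}^\epsilon\mapsto a\in A_g^\epsilon$; $\mathrm{var}^\sharp(A)$ is the class of all $(G,* )$-algebras $B$ with $\mathrm{Id}^\sharp(A)\subseteq\mathrm{Id}^\sharp(B)$. $P_n^\sharp$ is the span of all $w_{\sigma(1)}\cdots w_{\sigma(n)}$, $\sigma\in S_n$, $w_i\in\{x_{i,g}^\pm:g\in G\}$; $c_n^\sharp(A)=\dim_FP_n^\sharp/(P_n^\sharp\cap\mathrm{Id}^\sharp(A))$; quadratic codimension growth means $c_n^\sharp(A)=qn^2+\mathcal{O}(n)$,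 $q>0$. A proper polynomial is a linear combination of products of variables and commutators of variables in which variables $x_{i,1}^+$ occur only inside commutators. For $t^\epsilon\neq1^+$, $\Gamma_{(1_{1^+},1_{t^\epsilon})}$ is the space of multilinear proper polynomials in $x_{1,1}^+$ and $x_{2,t}^\epsilon$ (it is spanned by $[x_{1,1}^+,x_{2,t}^\epsilon]$), and $m_{((1)_{1^+},(1)_{t^\epsilon})}$ is the multiplicity of the (unique) irreducible character $\chi_{(1)}\otimes\chi_{(1)}$ of $S_1\times S_1$ in $\Gamma_{(1_{1^+},1_{t^\epsilon})}/(\Gamma_{(1_{1^+},1_{t^\epsilon})}\cap\mathrm{Id}^\sharp(A))$, i.e. the dimension of this quotient. $N_3=\mathrm{span}_F\{I_6,\ e_{23}+e_{45},\ e_{12}-e_{56},\ e_{13},\ e_{46}\}$ and $U_3=\mathrm{span}_F\{I_6,\ e_{23}+e_{45},\ e_{12}+e_{56},\ e_{13},\ e_{46}\}$, subalgebras of $UT_6(F)$. For $g\in G$, $N_{3,*}^g$ and $U_{3,*}^g$ are these algebras with the elementary grading induced by $(g_1,\dots,g_6)=(1,g,g,1,1,g)$ (so $e_{ij}$ has degree $g_i^{-1}g_j$) and the reflection involution $e_{ij}\mapsto e_{7-j,7-i}$. *)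

(* Defs.v *)
From HB Require Import structures.
From mathcomp Require Import all_boot all_order all_fingroup all_algebra all_field.
From mathcomp Require Import boolp classical_sets reals.
From mathcomp Require Import monalg.
From mathcomp Require Import zify.

Set Implicit Arguments.
Unset Strict Implicit.
Unset Printing Implicit Defensive.

Import Order.TTheory GRing.Theory Num.Theory.

Local Open Scope classical_set_scope.
Local Open Scope ring_scope.

Definition is_subspace (F : fieldType) (V : lmodType F) (S : set V) : Prop :=
  S 0 /\ forall (k : F) (u v : V), S u -> S v -> S (k *: u + v).

Definition lin_span (F : fieldType) (V : lmodType F) (S : set V) : set V :=
  [set v | exists n (c : 'I_n -> F) (b : 'I_n -> V),
             (forall i, S (b i)) /\ v = \sum_(i < n) c i *: b i].

(* The images of b_0, ..., b_(d-1) form a basis of U / W (for W inside U).    *)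
Definition has_quo_dim (F : fieldType) (V : lmodType F) (U W : set V)
    (d : nat) : Prop :=
  exists b : 'I_d -> V,
    [/\ forall i, U (b i),
        forall c : 'I_d -> F, W (\sum_(i < d) c i *: b i) -> forall i, c i = 0
      & forall u, U u ->
          exists c : 'I_d -> F, W (u - \sum_(i < d) c i *: b i)].

(* dim U / W; the junk value 0 is returned when the quotient is infinite      *)
(* dimensional, a case that does not arise for the spaces considered below.   *)
Definition quo_dim (F : fieldType) (V : lmodType F) (U W : set V) : nat :=
  xget 0%N [set d | has_quo_dim U W d].

Record gsAlgebra (F : fieldType) (G : finGroupType) := GSAlgebra {
  gs_carrier :> algType F;
  gs_comp : G -> set gs_carrier;
  gs_star : gs_carrier -> gs_carrier;
  gs_comp_subspace : forall g, is_subspace (gs_comp g);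
  gs_comp_direct : forall a : gs_carrier,
    exists! d : {ffun G -> gs_carrier},
      (forall g, gs_comp g (d g)) /\ a = \sum_(g : G) d g;
  gs_compM : forall (g h : G) (a b : gs_carrier),
    gs_comp g a -> gs_comp h b -> gs_comp (g * h)%g (a * b);
  gs_star_linear : forall (k : F) (a b : gs_carrier),
    gs_star (k *: a + b) = k *: gs_star a + gs_star b;
  gs_starM : forall a b, gs_star (a * b) = gs_star b * gs_star a;
  gs_starK : forall a, gs_star (gs_star a) = a;
  gs_star_comp : forall g, gs_star @` gs_comp g = gs_comp g
}.

(* A_g^+ for e = true and A_g^- for e = false.                                *)
Definition gs_part (F : fieldType) (G : finGroupType) (A : gsAlgebra F G)
    (g : G) (e : bool) : set A :=
  [set a | gs_comp g a /\ gs_star a = if e then a else - a].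

Definition is_left_ideal (R : nzRingType) (I : set R) : Prop :=
  [/\ I 0, forall x y, I x -> I y -> I (x + y) & forall r x, I x -> I (r * x)].

Definition is_maximal_left_ideal (R : nzRingType) (I : set R) : Prop :=
  [/\ is_left_ideal I, I <> setT
    & forall K : set R, is_left_ideal K -> I `<=` K -> K = I \/ K = setT].

Definition jacobson_radical (R : nzRingType) : set R :=
  [set x | forall I : set R, is_maximal_left_ideal I -> I x].

Definition of_type_FJ (F : fieldType) (A : algType F) : Prop :=
  forall a : A, exists (k : F) (j : A), jacobson_radical j /\ a = k%:A + j.

(* (i, g, e) stands for x_{i+1,g}^+ if e = true, x_{i+1,g}^- if e = false:    *)
(* the variables are indexed from 0 instead of 1.                             *)
Definition gvar (G : finGroupType) : choiceType := (nat * G * bool)%type.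

Notation free_gs F G := {malg F[{fmonom gvar G}]}.

Definition Xv (F : fieldType) (G : finGroupType) (v : gvar G) : free_gs F G :=
  mkmalgU (fmu v) 1.

Definition gs_eval (F : fieldType) (G : finGroupType) (A : gsAlgebra F G)
    (rho : gvar G -> A) (f : free_gs F G) : A :=
  mmap (fun k : F => k%:A) (fun m : {fmonom gvar G} => \prod_(v <- m) rho v) f.

Definition IdS (F : fieldType) (G : finGroupType) (A : gsAlgebra F G) :
    set (free_gs F G) :=
  [set f | forall rho : gvar G -> A,
             (forall i g e, gs_part g e (rho (i, g, e))) -> gs_eval rho f = 0].

(* B belongs to the variety generated by A.                                   *)
Definition in_varS (F : fieldType) (G : finGroupType) (B A : gsAlgebra F G) :
    Prop :=
  IdS A `<=` IdS B.

Definition PS (F : fieldType) (G : finGroupType) (n : nat) :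
    set (free_gs F G) :=
  lin_span [set p | exists (w : 'I_n -> G * bool) (s : 'S_n),
    p = \prod_(i < n) Xv F (nat_of_ord (s i), (w (s i)).1, (w (s i)).2)].
Arguments PS F G n : clear implicits.

Definition codimS (F : fieldType) (G : finGroupType) (A : gsAlgebra F G)
    (n : nat) : nat :=
  quo_dim (PS F G n) (PS F G n `&` IdS A).

Definition quadratic_growth (R : realType) (c : nat -> nat) : Prop :=
  exists q C : R, 0 < q /\
    exists N : nat, forall n, (N <= n)%N ->
      `|(c n)%:R - q * n%:R ^+ 2| <= C * n%:R.

(* The left-normed commutator [v, v_1, ..., v_k], where vs = v_1, ..., v_k.   *)
Definition lcommutator (F : fieldType) (G : finGroupType) (v : gvar G)
    (vs : seq (gvar G)) : free_gs F G :=
  foldl (fun p w => p * Xv F w - Xv F w * p) (Xv F v) vs.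

Definition is_var_1plus (G : finGroupType) (v : gvar G) : bool :=
  (v.1.2 == 1%g) && v.2.

Definition proper_factor (F : fieldType) (G : finGroupType) :
    set (free_gs F G) :=
  [set p | (exists v : gvar G, ~~ is_var_1plus v /\ p = Xv F v) \/
           (exists (v w : gvar G) (vs : seq (gvar G)),
              p = lcommutator F v (w :: vs))].

Definition proper_poly (F : fieldType) (G : finGroupType) :
    set (free_gs F G) :=
  lin_span [set p | exists fs : seq (free_gs F G),
    (forall f, f \in fs -> proper_factor f) /\ p = \prod_(f <- fs) f].
Arguments proper_poly F G : clear implicits.

Definition multilinear_in (F : fieldType) (G : finGroupType)
    (vs : seq (gvar G)) : set (free_gs F G) :=
  lin_span [set p | exists ws : seq (gvar G),
    perm_eq ws vs /\ p = \prod_(w <- ws) Xv F w].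
Arguments multilinear_in F {G} vs.

(* The two variables are x_{1,1}^+ and x_{2,t}^e in the indexing from 1.      *)
Definition Gamma11 (F : fieldType) (G : finGroupType) (t : G) (e : bool) :
    set (free_gs F G) :=
  proper_poly F G `&`
  multilinear_in F [:: (0%N, 1%g, true) : gvar G; (1%N, t, e) : gvar G].
Arguments Gamma11 F {G} t e.

(* S_1 x S_1 being trivial, the multiplicity of its only irreducible          *)
(* character in a module is the dimension of that module.                     *)
Definition mult11 (F : fieldType) (G : finGroupType) (A : gsAlgebra F G)
    (t : G) (e : bool) : nat :=
  quo_dim (Gamma11 F t e) (Gamma11 F t e `&` IdS A).

(* The matrix unit e_{ij}, with the usual indices 1 <= i, j <= 6.             *)
Definition e6 (F : fieldType) (i j : nat) : 'M[F]_6 :=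
  \matrix_(k, l) ((k.+1 == i) && (l.+1 == j))%:R.

Definition reflect_mx (F : fieldType) (n : nat) (M : 'M[F]_n) : 'M[F]_n :=
  \matrix_(i, j) M (rev_ord j) (rev_ord i).

Definition elem_homog (F : fieldType) (G : finGroupType) (n : nat)
    (gs : 'I_n -> G) (g : G) (M : 'M[F]_n) : Prop :=
  forall i j, M i j != 0 -> ((gs i)^-1 * gs j)%g = g.

Section ElementaryReflection.
Variables (F : fieldType) (G : finGroupType) (gs : 'I_6 -> G).
Variables (n : nat) (X : n.-tuple 'M[F]_6) (d : 'I_n -> G).
Variable A : {aspace 'M[F]_6}.
Hypothesis spanA : (A : {vspace 'M[F]_6}) = <<X>>%VS.
Hypothesis homX : forall k, elem_homog gs (d k) X`_k.
Hypothesis homrX : forall k, elem_homog gs (d k) (reflect_mx X`_k).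
Hypothesis rX : forall k : 'I_n, reflect_mx X`_k \in A.

Definition er_comp (g : G) : set (subvs_of A) :=
  [set a | elem_homog gs g (vsval a)].

Definition er_star (a : subvs_of A) : subvs_of A :=
  vsproj A (reflect_mx (vsval a)).

Let hproj (g : G) (M : 'M[F]_6) : 'M[F]_6 :=
  \matrix_(i, j) (if ((gs i)^-1 * gs j)%g == g then M i j else 0).

Fact elem_homog_comb g (k : F) (M N : 'M[F]_6) :
  elem_homog gs g M -> elem_homog gs g N -> elem_homog gs g (k *: M + N).
Proof.
move=> hM hN i j; rewrite !mxE => nz.
have [M0|Mn0] := eqVneq (M i j) 0; last exact: hM.
by apply: hN; move: nz; rewrite M0 mulr0 add0r.
Qed.

Fact elem_homog0 g : elem_homog gs g (0 : 'M[F]_6).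
Proof. by move=> i j; rewrite mxE eqxx. Qed.

Fact elem_homog_sum g (I : finType) (P : pred I) (c : I -> F)
    (M : I -> 'M[F]_6) :
  (forall i, P i -> elem_homog gs g (M i)) ->
  elem_homog gs g (\sum_(i | P i) c i *: M i).
Proof.
move=> hM; elim/big_rec: _ => [|i x Pi hx]; first exact: elem_homog0.
by apply: elem_homog_comb => //; apply: hM.
Qed.

Fact reflect_mx_linear (k : F) (M N : 'M[F]_6) :
  reflect_mx (k *: M + N) = k *: reflect_mx M + reflect_mx N.
Proof. by apply/matrixP => i j; rewrite !mxE. Qed.

Fact reflect_mx0 : reflect_mx (0 : 'M[F]_6) = 0.
Proof. by apply/matrixP => i j; rewrite !mxE. Qed.

Fact reflect_mx_sum (I : finType) (P : pred I) (c : I -> F)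
    (M : I -> 'M[F]_6) :
  reflect_mx (\sum_(i | P i) c i *: M i)
  = \sum_(i | P i) c i *: reflect_mx (M i).
Proof.
apply: (big_rec2 (fun x y => reflect_mx x = y)); first exact: reflect_mx0.
by move=> i y x _ <-; rewrite reflect_mx_linear.
Qed.

Fact reflect_mxK (M : 'M[F]_6) : reflect_mx (reflect_mx M) = M.
Proof. by apply/matrixP => i j; rewrite !mxE !rev_ordK. Qed.

Fact reflect_mxM (M N : 'M[F]_6) :
  reflect_mx (M * N) = reflect_mx N * reflect_mx M.
Proof.
apply/matrixP => i j; rewrite !mxE (reindex_inj rev_ord_inj) /=.
by apply: eq_bigr => k _; rewrite !mxE mulrC.
Qed.

Fact reflect_mx_mem (M : 'M[F]_6) : M \in A -> reflect_mx M \in A.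
Proof.
rewrite {1}spanA => /coord_span ->; rewrite reflect_mx_sum.
by apply: rpred_sum => k _; apply: rpredZ; apply: rX.
Qed.

Fact hproj_comb (g : G) (M : 'M[F]_6) : M \in A ->
  hproj g M = \sum_(k | d k == g) coord X k M *: X`_k.
Proof.
rewrite spanA => /coord_span MX; apply/matrixP => i j.
rewrite mxE {1}MX !summxE; case: eqP => [gij|gij].
  rewrite [RHS]big_mkcond; apply: eq_bigr => k _; rewrite mxE.
  case: eqP => // /eqP dk; have [->|nz] := eqVneq (X`_k i j) 0.
    by rewrite mulr0.
  by rewrite -(homX nz) gij eqxx in dk.
rewrite big1 // => k /eqP dk; rewrite mxE.
have [->|nz] := eqVneq (X`_k i j) 0; first by rewrite mulr0.
by case: gij; rewrite (homX nz).
Qed.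

Fact hproj_mem g (M : 'M[F]_6) : M \in A -> hproj g M \in A.
Proof.
move=> MA; rewrite (hproj_comb g MA) spanA.
by apply: rpred_sum => k _; apply/rpredZ/memv_span/mem_nth; rewrite size_tuple.
Qed.

Fact hproj_id g (M : 'M[F]_6) : elem_homog gs g M -> hproj g M = M.
Proof.
move=> hM; apply/matrixP => i j; rewrite mxE; case: eqP => // gij.
by have [//|/hM] := eqVneq (M i j) 0.
Qed.

Fact hproj_homog g (M : 'M[F]_6) : elem_homog gs g (hproj g M).
Proof. by move=> i j; rewrite mxE; case: (_ =P g) => // _ /eqP[]. Qed.

Fact vsval_er_star (a : subvs_of A) :
  vsval (er_star a) = reflect_mx (vsval a).
Proof. by rewrite vsprojK // reflect_mx_mem // subvsP. Qed.

Fact er_comp_subspace g : is_subspace (er_comp g).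
Proof.
split; first by rewrite /er_comp /=; exact: elem_homog0.
by move=> k u v hu hv; rewrite /er_comp /=; apply: elem_homog_comb.
Qed.

Fact er_comp_direct (a : subvs_of A) :
  exists! f : {ffun G -> subvs_of A},
    (forall g, er_comp g (f g)) /\ a = \sum_(g : G) f g.
Proof.
have Pa g : vsval (vsproj A (hproj g (vsval a))) = hproj g (vsval a).
  by rewrite vsprojK // hproj_mem // subvsP.
exists [ffun g => vsproj A (hproj g (vsval a))]; split.
  split=> [g|]; first by rewrite ffunE /er_comp /= Pa; apply: hproj_homog.
  apply: val_inj; rewrite /= linear_sum /=; apply/matrixP => i j.
  rewrite summxE (bigD1 ((gs i)^-1 * gs j)%g) //= ffunE Pa mxE eqxx.
  rewrite big1 ?addr0 // => g /negPf gij.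
  by rewrite ffunE Pa mxE eq_sym gij.
move=> f [hf aE]; apply/ffunP => g; rewrite ffunE; apply: val_inj.
rewrite /= Pa aE linear_sum /=; apply/matrixP => i j; rewrite mxE.
case: eqP => [gij|gij]; last first.
  by have [-> //|/hf /gij] := eqVneq (vsval (f g) i j) 0.
rewrite summxE (bigD1 g) //= big1 ?addr0 // => h hg.
have [//|/hf] := eqVneq (vsval (f h) i j) 0.
by rewrite gij => gh; rewrite gh eqxx in hg.
Qed.

Fact er_compM g h (a b : subvs_of A) :
  er_comp g a -> er_comp h b -> er_comp (g * h)%g (a * b).
Proof.
move=> ha hb i j; rewrite /= mxE => nz.
have [k kP] : exists k, vsval a i k * vsval b k j != 0.
  apply/existsP; apply: contraR nz; rewrite negb_exists => /forallP z.
  by rewrite big1 // => k _; apply/eqP; have := z k; rewrite negbK.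
move: kP; rewrite mulf_eq0 negb_or => /andP[/ha <- /hb <-].
by rewrite mulgA mulgK.
Qed.

Fact er_star_linear (k : F) (a b : subvs_of A) :
  er_star (k *: a + b) = k *: er_star a + er_star b.
Proof.
apply: val_inj; rewrite /= !vsval_er_star /=.
exact: reflect_mx_linear.
Qed.

Fact er_starM (a b : subvs_of A) : er_star (a * b) = er_star b * er_star a.
Proof. by apply: val_inj; rewrite /= !vsval_er_star /= reflect_mxM. Qed.

Fact er_starK (a : subvs_of A) : er_star (er_star a) = a.
Proof. by apply: val_inj; rewrite /= !vsval_er_star reflect_mxK. Qed.

Fact er_star_homog g (a : subvs_of A) : er_comp g a -> er_comp g (er_star a).
Proof.
rewrite /er_comp /= vsval_er_star => /hproj_id <-.
rewrite (hproj_comb g (subvsP a)) reflect_mx_sum.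
by apply: elem_homog_sum => k /eqP <-.
Qed.

Fact er_star_comp g : er_star @` er_comp g = er_comp g.
Proof.
rewrite eqEsubset; split=> [_ [a ha <-]|a ha]; first exact: er_star_homog.
by exists (er_star a); [exact: er_star_homog|exact: er_starK].
Qed.

Definition er_gsAlgebra : gsAlgebra F G :=
  GSAlgebra er_comp_subspace er_comp_direct er_compM er_star_linear er_starM
    er_starK er_star_comp.

End ElementaryReflection.

Definition gs6 (G : finGroupType) (g : G) (i : 'I_6) : G :=
  tnth [tuple 1%g; g; g; 1%g; 1%g; g] i.

Definition N3_gens (F : fieldType) : 5.-tuple 'M[F]_6 :=
  [tuple 1; e6 F 2 3 + e6 F 4 5; e6 F 1 2 - e6 F 5 6; e6 F 1 3; e6 F 4 6].

Definition U3_gens (F : fieldType) : 5.-tuple 'M[F]_6 :=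
  [tuple 1; e6 F 2 3 + e6 F 4 5; e6 F 1 2 + e6 F 5 6; e6 F 1 3; e6 F 4 6].

Definition gens_deg (G : finGroupType) (g : G) (k : 'I_5) : G :=
  tnth [tuple 1%g; 1%g; g; g; g] k.

Fact e6M (F : fieldType) i j k l : (0 < j <= 6)%N ->
  e6 F i j * e6 F k l = (j == k)%:R *: e6 F i l.
Proof.
case: j => // j /andP[_ j6]; apply/matrixP => a b.
rewrite !mxE (bigD1 (Ordinal j6)) //= big1 ?addr0 => [|c cj]; last first.
  rewrite !mxE eqSS (_ : (c == j :> nat) = false) ?andbF ?mul0r //.
  by apply: contraNF cj => /eqP cj; apply/eqP/val_inj.
rewrite !mxE eqxx andbT.
by case: (a.+1 == i); case: (_ == k); case: (b.+1 == l);
  rewrite ?mulr0 ?mul0r ?mulr1.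
Qed.

Fact reflect_e6 (F : fieldType) i j : (0 < i <= 6)%N -> (0 < j <= 6)%N ->
  reflect_mx (e6 F i j) = e6 F (7 - j) (7 - i).
Proof.
move=> hi hj; apply/matrixP => a b; rewrite !mxE /= andbC.
have := ltn_ord a; have := ltn_ord b => b6 a6.
by congr (_ && _)%:R; apply/eqP/eqP; lia.
Qed.

Fact reflect_1 (F : fieldType) : reflect_mx (1 : 'M[F]_6) = 1.
Proof.
by apply/matrixP => i j; rewrite !mxE (inj_eq rev_ord_inj) eq_sym.
Qed.

Fact reflectD (F : fieldType) (M N : 'M[F]_6) :
  reflect_mx (M + N) = reflect_mx M + reflect_mx N.
Proof. by apply/matrixP => i j; rewrite !mxE. Qed.

Fact reflectN (F : fieldType) (M : 'M[F]_6) :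
  reflect_mx (- M) = - reflect_mx M.
Proof. by apply/matrixP => i j; rewrite !mxE. Qed.

Fact span_aspace (F : fieldType) (n : nat) (X : n.-tuple 'M[F]_6) :
  1 \in X -> (forall i j : 'I_n, X`_i * X`_j \in <<X>>%VS) ->
  is_aspace <<X>>%VS.
Proof.
move=> X1 XM; rewrite /is_aspace has_algid1 ?memv_span //=.
apply/prodvP => u v /coord_span -> /coord_span ->.
rewrite mulr_suml; apply: rpred_sum => i _.
rewrite mulr_sumr; apply: rpred_sum => j _.
by rewrite -scalerAl -scalerAr; do 2!apply: rpredZ.
Qed.

Fact N3_is_aspace (F : fieldType) : is_aspace <<N3_gens F>>%VS.
Proof.
apply: span_aspace; first by rewrite inE eqxx.
pose X := N3_gens F.
have XP k : (k < 5)%N -> X`_k \in <<X>>%VS.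
  by move=> k5; apply/memv_span/mem_nth; rewrite size_tuple.
have X0 := XP 0%N isT; have X1 := XP 1%N isT; have X2 := XP 2%N isT.
have X3 := XP 3%N isT; have X4 := XP 4%N isT.
move: X0 X1 X2 X3 X4; rewrite -/X; set S := <<X>>%VS => /= X0 X1 X2 X3 X4.
move=> [i i5] [j j5].
do 5?[case: i i5 => [|i] i5 //=]; do 5?[case: j j5 => [|j] j5 //=];
  rewrite ?mul1r ?mulr1 //;
  rewrite ?mulrDl ?mulrDr ?mulNr ?mulrN ?e6M //=
    ?mulrDr ?mulrN ?e6M //= ?scale0r ?scale1r ?oppr0 ?addr0 ?add0r ?opprK ?rpred0
    ?rpredN //.
Qed.

Fact U3_is_aspace (F : fieldType) : is_aspace <<U3_gens F>>%VS.
Proof.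
apply: span_aspace; first by rewrite inE eqxx.
pose X := U3_gens F.
have XP k : (k < 5)%N -> X`_k \in <<X>>%VS.
  by move=> k5; apply/memv_span/mem_nth; rewrite size_tuple.
have X0 := XP 0%N isT; have X1 := XP 1%N isT; have X2 := XP 2%N isT.
have X3 := XP 3%N isT; have X4 := XP 4%N isT.
move: X0 X1 X2 X3 X4; rewrite -/X; set S := <<X>>%VS => /= X0 X1 X2 X3 X4.
move=> [i i5] [j j5].
do 5?[case: i i5 => [|i] i5 //=]; do 5?[case: j j5 => [|j] j5 //=];
  rewrite ?mul1r ?mulr1 //;
  rewrite ?mulrDl ?mulrDr ?e6M //= ?mulrDr ?e6M //=
    ?scale0r ?scale1r ?addr0 ?add0r ?rpred0 //.
Qed.

Definition N3 (F : fieldType) : {aspace 'M[F]_6} := ASpace (N3_is_aspace F).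

Definition U3 (F : fieldType) : {aspace 'M[F]_6} := ASpace (U3_is_aspace F).

Fact elem_homog1 (F : fieldType) (G : finGroupType) (gs : 'I_6 -> G) :
  elem_homog gs 1%g (1 : 'M[F]_6).
Proof.
move=> i j; rewrite mxE; case: (i =P j) => [-> _|_]; first exact: mulVg.
by move=> /eqP[].
Qed.

Fact elem_homog_e6 (F : fieldType) (G : finGroupType) (gs : 'I_6 -> G) (d : G)
    (i j : nat) :
  (forall a b : 'I_6, a.+1 = i -> b.+1 = j -> ((gs a)^-1 * gs b)%g = d) ->
  elem_homog gs d (e6 F i j).
Proof.
move=> h a b; rewrite mxE.
case: (_ =P i) => [ai|_]; last by move=> /eqP[].
by case: (_ =P j) => [bj _|_]; [exact: h|move=> /eqP[]].
Qed.

Fact elem_homogD (F : fieldType) (G : finGroupType) (gs : 'I_6 -> G) (d : G)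
    (M N : 'M[F]_6) :
  elem_homog gs d M -> elem_homog gs d N -> elem_homog gs d (M + N).
Proof. by move=> hM hN; rewrite -[M]scale1r; apply: elem_homog_comb. Qed.

Fact elem_homogN (F : fieldType) (G : finGroupType) (gs : 'I_6 -> G) (d : G)
    (M : 'M[F]_6) :
  elem_homog gs d M -> elem_homog gs d (- M).
Proof. by move=> hM i j; rewrite mxE oppr_eq0; apply: hM. Qed.

Fact gs6_homog (F : fieldType) (G : finGroupType) (g : G) :
  [/\ elem_homog (gs6 g) 1%g (e6 F 2 3), elem_homog (gs6 g) 1%g (e6 F 4 5),
      elem_homog (gs6 g) g (e6 F 1 2), elem_homog (gs6 g) g (e6 F 5 6)
    & elem_homog (gs6 g) g (e6 F 1 3) /\ elem_homog (gs6 g) g (e6 F 4 6)].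
Proof.
have h i j d : (forall a b, (a.+1 = i)%N -> (b.+1 = j)%N ->
    ((nth 1%g [:: 1%g; g; g; 1%g; 1%g; g] a)^-1
      * nth 1%g [:: 1%g; g; g; 1%g; 1%g; g] b)%g = d) ->
    elem_homog (gs6 g) d (e6 F i j).
  move=> hd; apply: elem_homog_e6 => a b ai bj.
  by rewrite /gs6 !(tnth_nth 1%g) /=; apply: hd.
by split; [| | | |split]; apply: h => _ _ [->] [->] /=;
  rewrite ?invg1 ?mul1g ?mulVg.
Qed.

Fact N3_homog (F : fieldType) (G : finGroupType) (g : G) (k : 'I_5) :
  elem_homog (gs6 g) (gens_deg g k) (N3_gens F)`_k.
Proof.
have [h23 h45 h12 h56 [h13 h46]] := @gs6_homog F G g.
rewrite /gens_deg (tnth_nth 1%g); case: k => k k5 /=.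
do 5?[case: k k5 => [|k] k5 //=]; [exact: elem_homog1| |];
  by apply: elem_homogD => //; apply: elem_homogN.
Qed.

Fact U3_homog (F : fieldType) (G : finGroupType) (g : G) (k : 'I_5) :
  elem_homog (gs6 g) (gens_deg g k) (U3_gens F)`_k.
Proof.
have [h23 h45 h12 h56 [h13 h46]] := @gs6_homog F G g.
rewrite /gens_deg (tnth_nth 1%g); case: k => k k5 /=.
by do 5?[case: k k5 => [|k] k5 //=]; [exact: elem_homog1| |];
  apply: elem_homogD.
Qed.

Fact reflect_N3 (F : fieldType) (k : 'I_5) :
  reflect_mx (N3_gens F)`_k
  = nth 0 [:: 1; e6 F 2 3 + e6 F 4 5; - (e6 F 1 2 - e6 F 5 6); e6 F 4 6;
              e6 F 1 3] k.
Proof.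
case: k => k k5 /=; do 5?[case: k k5 => [|k] k5 //=];
  rewrite ?reflect_1 ?reflectD ?reflectN ?reflect_e6 //=.
- exact: addrC.
- by rewrite opprB addrC.
Qed.

Fact reflect_U3 (F : fieldType) (k : 'I_5) :
  reflect_mx (U3_gens F)`_k
  = nth 0 [:: 1; e6 F 2 3 + e6 F 4 5; e6 F 1 2 + e6 F 5 6; e6 F 4 6;
              e6 F 1 3] k.
Proof.
by case: k => k k5 /=; do 5?[case: k k5 => [|k] k5 //=];
  rewrite ?reflect_1 ?reflectD ?reflect_e6 //= addrC.
Qed.

Fact N3_reflect_homog (F : fieldType) (G : finGroupType) (g : G) (k : 'I_5) :
  elem_homog (gs6 g) (gens_deg g k) (reflect_mx (N3_gens F)`_k).
Proof.
have [h23 h45 h12 h56 [h13 h46]] := @gs6_homog F G g.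
rewrite reflect_N3 /gens_deg (tnth_nth 1%g); case: k => k k5 /=.
do 5?[case: k k5 => [|k] k5 //=]; first exact: elem_homog1.
- exact: elem_homogD.
- by apply: elem_homogN; apply: elem_homogD => //; apply: elem_homogN.
Qed.

Fact U3_reflect_homog (F : fieldType) (G : finGroupType) (g : G) (k : 'I_5) :
  elem_homog (gs6 g) (gens_deg g k) (reflect_mx (U3_gens F)`_k).
Proof.
have [h23 h45 h12 h56 [h13 h46]] := @gs6_homog F G g.
rewrite reflect_U3 /gens_deg (tnth_nth 1%g); case: k => k k5 /=.
by do 5?[case: k k5 => [|k] k5 //=]; [exact: elem_homog1| |];
  apply: elem_homogD.
Qed.

Fact N3_reflect_mem (F : fieldType) (k : 'I_5) :
  reflect_mx (N3_gens F)`_k \in N3 F.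
Proof.
rewrite reflect_N3; change (N3 F : {vspace _}) with <<N3_gens F>>%VS.
case: k => k k5 /=; do 5?[case: k k5 => [|k] k5 //=]; rewrite ?memvN;
  by apply: memv_span; rewrite !inE eqxx ?orbT.
Qed.

Fact U3_reflect_mem (F : fieldType) (k : 'I_5) :
  reflect_mx (U3_gens F)`_k \in U3 F.
Proof.
rewrite reflect_U3; change (U3 F : {vspace _}) with <<U3_gens F>>%VS.
case: k => k k5 /=; do 5?[case: k k5 => [|k] k5 //=];
  by apply: memv_span; rewrite !inE eqxx ?orbT.
Qed.

Definition N3_gs (F : fieldType) (G : finGroupType) (g : G) : gsAlgebra F G :=
  er_gsAlgebra (A := N3 F) (erefl _) (@N3_homog F G g) (@N3_reflect_homog F G g)
    (N3_reflect_mem F).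

Definition U3_gs (F : fieldType) (G : finGroupType) (g : G) : gsAlgebra F G :=
  er_gsAlgebra (A := U3 F) (erefl _) (@U3_homog F G g) (@U3_reflect_homog F G g)
    (U3_reflect_mem F).

(* Main.v *)
(* The algebras N_3 and U_3 have the form F + J with J^3 = 0 and J spanned by
   a, b, ab, ba, where a is in the part 1^+ and b in the part g^e.  Hence the
   value of a polynomial f on them only involves the terms of f of degree at
   most two around a scalar point c: the value f(c), its first derivatives and
   its mixed second derivatives, which are scalars.  If f is an identity of A,
   evaluating it at c + l t for all scalars l makes each homogeneous component
   in l vanish on A.  When u in A_1^+ and w in A_g^e do not commute, 1, w and
   [u, w] are nonzero elements of A_1^+, A_g^e and A_g^(-e), which kills f(c) and
   the first derivatives; taking u and 1 in turn in the mixed term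
   K uw + K' wu = 0 gives K = K' = 0.  So f is an identity of the triangular
   algebra.  Finally the space Gamma is spanned by the commutator, since a proper
   polynomial is unchanged when a scalar is added to x_1^+. *)

Require Import Defs.
From HB Require Import structures.
From mathcomp Require Import all_boot all_fingroup all_algebra all_field.
From mathcomp Require Import boolp classical_sets reals.
From mathcomp Require Import finmap monalg.

Set Implicit Arguments.
Unset Strict Implicit.
Unset Printing Implicit Defensive.

Import GRing.Theory.

Local Open Scope classical_set_scope.
Local Open Scope ring_scope.

(** * Separating coefficients by scalar substitutions *)

Lemma horner_scalar_eq0 (F : fieldType) (A : algType F) (q : {poly A}) :
  [pchar F] =i pred0 -> (forall l : F, q.[l%:A] = 0) -> q = 0.
Proof.
move=> F0 q0.
have ev (p : nat -> A) (n : nat) :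
    (forall l : F, \sum_(i < n) l ^+ i *: p i = 0) ->
    forall i, (i < n)%N -> p i = 0.
  elim: n p => [//|n IHn] p p0.
  (* Substituting [2 l] for [l] and subtracting [2 ^ n] times the original
     relation eliminates the top coefficient. *)
  have low i : (i < n)%N -> p i = 0.
    move=> lt_in; suff: (2 ^+ i - 2 ^+ n : F) *: p i = 0.
      have nz : (2 ^+ i - 2 ^+ n : F) != 0.
        rewrite -oppr_eq0 opprB -!natrX -natrB; last by rewrite leq_exp2l // ltnW.
        by rewrite ((pcharf0P F).1 F0) subn_eq0 leq_exp2l // -ltnNge.
      by move=> /eqP; rewrite scaler_eq0 (negPf nz) => /eqP.
    apply: (IHn (fun i => (2 ^+ i - 2 ^+ n : F) *: p i)) lt_in => l.
    have := p0 (2 * l); have := p0 l; rewrite !big_ord_recr /= => e1 e2.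
    transitivity (\sum_(j < n) ((2 * l) ^+ j *: p j)
                  - 2 ^+ n *: \sum_(j < n) (l ^+ j *: p j)).
      rewrite scaler_sumr -sumrB; apply: eq_bigr => j _.
      by rewrite !scalerA -scalerBl exprMn mulrBr !(mulrC (l ^+ j)).
    move/eqP: e1; rewrite addr_eq0 => /eqP->.
    move/eqP: e2; rewrite addr_eq0 => /eqP->.
    by rewrite scalerN opprK scalerA exprMn addNr.
  move=> i; rewrite ltnS leq_eqVlt => /orP[/eqP->|]; last exact: low.
  (* With the lower coefficients gone, the relation at [l = 1] is the top coefficient. *)
  have := p0 1; rewrite big_ord_recr /= expr1n scale1r big1 ?add0r // => j _.
  by rewrite low ?scaler0.
apply/polyP => i; rewrite coef0.
have [lt_iq|?] := ltnP i (size q); last by rewrite nth_default.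
apply: (ev (fun i => q`_i) (size q)) => // l.
apply: etrans (q0 l); rewrite horner_coef; apply: eq_bigr => j _.
by rewrite exprZn expr1n mulr_algr.
Qed.

(** * Taylor expansion of evaluations up to order two *)

Section Truncation.
Variables (F : fieldType) (G : finGroupType).
Implicit Types (c x y : gvar G -> F) (s : seq (gvar G)) (f : free_gs F G).

(* [word1 c x s] and [word2 c x y s] are the coefficients of [u] and [u * w] in
   the product over [v] in [s] of [c v + x v u + y v w], [u] and [w] being
   noncommuting indeterminates. *)
Definition word0 c s : F := \prod_(v <- s) c v.

Fixpoint word1 c x s : F :=
  if s is v :: s' then c v * word1 c x s' + x v * word0 c s' else 0.

Fixpoint word2 c x y s : F :=
  if s is v :: s' then c v * word2 c x y s' + x v * word1 c y s' else 0.

(** For [phi] among [word0], [word1], [word2] these are the Taylor coefficients of [f] at [c]: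
    value, first derivatives, second-order coefficients. *)
Definition lin_words (phi : seq (gvar G) -> F) f : F :=
  \sum_(m <- msupp f) f@_m * phi m.

Lemma lin_wordsD phi psi f :
  lin_words (fun s => phi s + psi s) f = lin_words phi f + lin_words psi f.
Proof. by rewrite -big_split; apply: eq_bigr => m _; rewrite mulrDr. Qed.

Lemma word1D c x y s :
  word1 c (fun v => x v + y v) s = word1 c x s + word1 c y s.
Proof.
elim: s => [|v s IHs] /=; first by rewrite addr0.
by rewrite IHs mulrDr mulrDl addrACA.
Qed.

Lemma word1N c x s : word1 c (fun v => - x v) s = - word1 c x s.
Proof. by elim: s => [|v s IHs] /=; rewrite ?oppr0 // IHs mulrN mulNr opprD. Qed.

Lemma word2Nl c x y s : word2 c (fun v => - x v) y s = - word2 c x y s.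
Proof. by elim: s => [|v s IHs] /=; rewrite ?oppr0 // IHs mulrN mulNr opprD. Qed.

Lemma word2Nr c x y s : word2 c x (fun v => - y v) s = - word2 c x y s.
Proof.
by elim: s => [|v s IHs] /=; rewrite ?oppr0 // IHs word1N !mulrN opprD.
Qed.

Lemma lin_wordsN phi f : lin_words (fun s => - phi s) f = - lin_words phi f.
Proof. by rewrite -sumrN; apply: eq_bigr => m _; rewrite mulrN. Qed.

Lemma eq_lin_words phi psi f : phi =1 psi -> lin_words phi f = lin_words psi f.
Proof. by move=> e; apply: eq_bigr => m _; rewrite e. Qed.

Lemma gs_evalE (A : gsAlgebra F G) (rho : gvar G -> A) f :
  gs_eval rho f = \sum_(m <- msupp f) f@_m *: \prod_(v <- m) rho v.
Proof. by apply: eq_bigr => m _; rewrite mulr_algl. Qed.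

Variable A : gsAlgebra F G.
Variables (c x y : gvar G -> F) (u w : A).

(** The word [s] along the line through [c] in direction [x u + y w], the indeterminate being the
    parameter of the line. *)
Let wpoly s : {poly A} :=
  \prod_(v <- s) ((c v)%:A%:P + (x v *: u + y v *: w)%:P * 'X).

Let wpoly_cons v s k : (wpoly (v :: s))`_k
  = c v *: (wpoly s)`_k
    + (if k is k'.+1 then (x v *: u + y v *: w) * (wpoly s)`_k' else 0).
Proof.
rewrite /wpoly big_cons mulrDl coefD coefCM mulr_algl -mulrA coefCM.
rewrite -commr_polyX coefMX.
by case: k => [|k] //=; rewrite mulr0.
Qed.

Let wpoly0 s : (wpoly s)`_0 = (word0 c s)%:A.
Proof.
elim: s => [|v s IHs]; first by rewrite /wpoly /word0 !big_nil coef1 scale1r.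
by rewrite wpoly_cons addr0 IHs /word0 big_cons scalerA.
Qed.

Let wpoly1 s : (wpoly s)`_1 = word1 c x s *: u + word1 c y s *: w.
Proof.
elim: s => [|v s IHs] /=.
  by rewrite /wpoly big_nil coef1 !scale0r addr0.
rewrite wpoly_cons IHs wpoly0 mulr_algr !scalerDr !scalerA !scalerDl.
by rewrite addrACA !(mulrC (word0 c s)).
Qed.

Let wpoly2 s : (wpoly s)`_2
  = (word2 c x x s *: (u * u) + word2 c y y s *: (w * w))
    + (word2 c x y s *: (u * w) + word2 c y x s *: (w * u)).
Proof.
elim: s => [|v s IHs] /=.
  by rewrite /wpoly big_nil coef1 !scale0r !addr0.
rewrite wpoly_cons IHs wpoly1 !mulrDl !mulrDr -!scalerAl -!scalerAr.
rewrite !scalerDr !scalerA !scalerDl.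
rewrite [_ *: (w * u) + _ *: (w * w)]addrC [X in _ + X = _]addrACA [LHS]addrACA.
by congr (_ + _); apply: addrACA.
Qed.

Let fpoly f : {poly A} := \sum_(m <- msupp f) (f@_m)%:A *: wpoly m.

Hypotheses (F0 : [pchar F] =i pred0) (f : free_gs F G) (fA : IdS A f).
Hypothesis part_cu : forall i g e l,
  gs_part g e ((c (i, g, e))%:A
               + l *: (x (i, g, e) *: u + y (i, g, e) *: w) : A).

(** At each scalar [l], [fpoly f] is the value of the identity [f] at an admissible evaluation, so
    [horner_scalar_eq0] applies. *)
Let fpoly_eq0 : fpoly f = 0.
Proof.
apply: horner_scalar_eq0 => // l.
rewrite -[RHS](fA (rho := fun v => (c v)%:A + l *: (x v *: u + y v *: w))) //.
rewrite gs_evalE /fpoly horner_sum; apply: eq_bigr => m _.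
rewrite hornerZ mulr_algl; congr (_ *: _).
elim: (m : seq _) => [|v s IHs]; first by rewrite /wpoly !big_nil hornerC.
(* Evaluation at [l%:A] is multiplicative because this element is central. *)
rewrite /wpoly !big_cons hornerM_comm; last first.
  by rewrite /comm_poly mulr_algl mulr_algr.
by rewrite IHs hornerD hornerMX !hornerC mulr_algr.
Qed.

Let coef_fpoly k : \sum_(m <- msupp f) f@_m *: (wpoly m)`_k = 0.
Proof.
rewrite -[RHS](coef0 _ k) -fpoly_eq0 coef_sum; apply: eq_bigr => m _.
by rewrite coefZ mulr_algl.
Qed.

Lemma IdS_word0 : lin_words (word0 c) f = 0.
Proof.
have := coef_fpoly 0; under eq_bigr do rewrite wpoly0 scalerA.
by rewrite -scaler_suml => /eqP; rewrite scaler_eq0 oner_eq0 orbF => /eqP.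
Qed.

Lemma IdS_word1 :
  lin_words (word1 c x) f *: u + lin_words (word1 c y) f *: w = 0.
Proof.
have := coef_fpoly 1; under eq_bigr do rewrite wpoly1 scalerDr !scalerA.
by rewrite big_split /= -!scaler_suml.
Qed.

Lemma IdS_word2 :
  (lin_words (word2 c x x) f *: (u * u) + lin_words (word2 c y y) f *: (w * w))
  + (lin_words (word2 c x y) f *: (u * w) + lin_words (word2 c y x) f *: (w * u))
  = 0.
Proof.
have := coef_fpoly 2; under eq_bigr do rewrite wpoly2 !scalerDr !scalerA.
by rewrite !big_split /= -!scaler_suml.
Qed.

End Truncation.

(** * Symmetric and skew homogeneous parts *)

Section Parts.
Variables (F : fieldType) (G : finGroupType) (A : gsAlgebra F G).
Implicit Types (a b : A) (k : F).

Lemma gs_comp_lin g k a b : gs_comp g a -> gs_comp g b -> gs_comp g (k *: a + b).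
Proof. exact: (gs_comp_subspace A g).2. Qed.

Lemma gs_comp0 g : gs_comp g (0 : A).
Proof. exact: (gs_comp_subspace A g).1. Qed.

Lemma gs_starD a b : gs_star (a + b) = gs_star a + gs_star b.
Proof. by rewrite -[a]scale1r gs_star_linear !scale1r. Qed.

Lemma gs_star0 : gs_star (0 : A) = 0.
Proof. by apply: (addrI (gs_star (0 : A))); rewrite -gs_starD !addr0. Qed.

Lemma gs_starZ k a : gs_star (k *: a) = k *: gs_star a.
Proof. by rewrite -[k *: a]addr0 gs_star_linear gs_star0 addr0. Qed.

Lemma gs_star1 : gs_star (1 : A) = 1.
Proof. by have := gs_starM 1 (gs_star (1 : A)); rewrite mul1r gs_starK mul1r. Qed.

Lemma gs_part_lin g e k a b :
  gs_part g e a -> gs_part g e b -> gs_part g e (k *: a + b).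
Proof.
move=> [ga sa] [gb sb]; split; first exact: gs_comp_lin.
by rewrite gs_star_linear sa sb; case: (e) => //; rewrite scalerN opprD.
Qed.

Lemma gs_part0 g e : gs_part g e (0 : A).
Proof. by split; [exact: gs_comp0|rewrite gs_star0 oppr0 if_same]. Qed.

Lemma gs_partZ g e k a : gs_part g e a -> gs_part g e (k *: a).
Proof.
by move=> pa; rewrite -[k *: a]addr0; apply: gs_part_lin (gs_part0 _ _).
Qed.

Lemma gs_partD g e a b : gs_part g e a -> gs_part g e b -> gs_part g e (a + b).
Proof. by move=> pa; rewrite -[a]scale1r; apply: gs_part_lin. Qed.

(* If [1] is the sum of the [d g], comparing components in [b = \sum_g d g * b]
   shows that [d 1] is a left unit for homogeneous [b]. *)
Lemma gs_comp1 : gs_comp 1%g (1 : A).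
Proof.
have [d [[hd d1] _]] := gs_comp_direct (1 : A).
suff d1l b : d 1%g * b = b by rewrite -(d1l 1) mulr1.
have hom h b' : gs_comp h b' -> d 1%g * b' = b'.
  move=> hb; have [d' [_ uniq_d']] := gs_comp_direct b'.
  have e1 : [ffun g => d (g * h^-1)%g * b'] = d'.
    apply/esym/uniq_d'; split=> [g|].
      by rewrite ffunE -{1}[g](mulgKV h); apply: gs_compM.
    rewrite -{1}[b']mul1r d1 mulr_suml (reindex_inj (mulIg h^-1%g)) /=.
    by apply: eq_bigr => g _; rewrite ffunE.
  have e2 : [ffun g => if g == h then b' else 0] = d'.
    apply/esym/uniq_d'; split=> [g|].
      by rewrite ffunE; case: eqP => [->|_] //; apply: gs_comp0.
    rewrite (bigD1 h) //= ffunE eqxx big1 ?addr0 // => g /negPf gh.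
    by rewrite ffunE gh.
  have /ffunP/(_ h) : [ffun g => d (g * h^-1)%g * b']
      = [ffun g => if g == h then b' else 0] by rewrite e1 e2.
  by rewrite !ffunE mulgV eqxx.
have [db [[hdb ->] _]] := gs_comp_direct b.
by rewrite mulr_sumr; apply: eq_bigr => g _; apply: hom (hdb g).
Qed.

Lemma gs_part1 : gs_part 1%g true (1 : A).
Proof. by split; [exact: gs_comp1|exact: gs_star1]. Qed.

(** The involution reverses products, hence the change of sign. Applied to [u] and [w], this gives a
    nonzero element in the part opposite to that of [w]. *)
Lemma gs_part_comm g e a b : gs_part 1%g true a -> gs_part g e b ->
  gs_part g (~~ e) (a * b - b * a).
Proof.
move=> [ga sa] [gb sb]; split.
  rewrite addrC -scaleN1r; apply: gs_comp_lin.
    by rewrite -[g]mulg1; apply: gs_compM.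
  by rewrite -[g]mul1g; apply: gs_compM.
rewrite gs_starD -[- (b * a)]scaleN1r gs_starZ !gs_starM sa sb.
by case: e {gb sb} => /=; rewrite !scaleN1r ?mulrN ?mulNr ?opprK ?opprB // addrC.
Qed.

End Parts.

(** * Transfer of identities from [A] to a nilpotent model *)

(** Under this condition [x v *: z] is an admissible value of every variable [v] when [z] lies in
    the part [(g, e)]. *)
Definition supported (F : fieldType) (G : finGroupType) (g : G) (e : bool)
    (x : gvar G -> F) : Prop :=
  forall v, x v != 0 -> v.1.2 = g /\ v.2 = e.

Section Transfer.
Variables (F : fieldType) (G : finGroupType) (A : gsAlgebra F G).
Hypothesis F0 : [pchar F] =i pred0.
Implicit Types (c x y : gvar G -> F) (f : free_gs F G).

Lemma supportedN g e x : supported g e x -> supported g e (fun v => - x v).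
Proof. by move=> sx v; rewrite oppr_eq0; apply: sx. Qed.

Lemma gs_part_supported g e x (u : A) i k d :
  supported g e x -> gs_part g e u -> gs_part k d (x (i, k, d) *: u).
Proof.
move=> sx pu; have [->|/sx /= [-> ->]] := eqVneq (x (i, k, d)) 0.
  by rewrite scale0r; apply: gs_part0.
exact: gs_partZ.
Qed.

Lemma IdS_word1_eq0 c g e x (z : A) f : supported 1%g true c ->
  supported g e x -> gs_part g e z -> z <> 0 -> IdS A f ->
  lin_words (word1 c x) f = 0.
Proof.
move=> sc sx pz nz fA.
(* A single direction [z] suffices, so the second one is set to [0]. *)
have := @IdS_word1 F G A c x x z 0 F0 f fA; rewrite scaler0 addr0.
have part i k d l :
    gs_part k d ((c (i, k, d))%:A
                 + l *: (x (i, k, d) *: z + x (i, k, d) *: 0) : A).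
  rewrite scaler0 addr0; apply: gs_partD.
    exact: gs_part_supported sc (gs_part1 A).
  by apply/gs_partZ/gs_part_supported; eassumption.
by move=> /(_ part)/eqP; rewrite scaler_eq0 => /orP[/eqP//|/eqP/nz].
Qed.

Variables (g : G) (e : bool) (u w : A).
Hypotheses (pu : gs_part 1%g true u) (pw : gs_part g e w).
Hypothesis nuw : u * w - w * u <> 0.

Lemma noncommuting_neq0 : w <> 0.
Proof. by move=> w0; apply: nuw; rewrite w0 mulr0 mul0r subrr. Qed.

(* [x] and [y] are told apart by the sign change of [y], and [u * w] from
   [w * u] by also evaluating [u] at [1]. *)
Lemma IdS_word2_eq0 c x y f : supported 1%g true c -> supported 1%g true x ->
  supported g e y -> IdS A f ->
  lin_words (word2 c x y) f = 0 /\ lin_words (word2 c y x) f = 0.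
Proof.
move=> sc sx sy fA.
have part (z : A) y' i k d l : gs_part 1%g true z -> supported g e y' ->
    gs_part k d ((c (i, k, d))%:A + l *: (x (i, k, d) *: z + y' (i, k, d) *: w)).
  move=> pz sy'; apply: gs_partD.
    exact: gs_part_supported sc (gs_part1 A).
  by apply/gs_partZ/gs_partD; apply: gs_part_supported; eassumption.
have mixed (z : A) : gs_part 1%g true z ->
    lin_words (word2 c x y) f *: (z * w) + lin_words (word2 c y x) f *: (w * z)
    = 0.
  move=> pz.
  have e1 := IdS_word2 F0 fA (fun i k d l => part z y i k d l pz sy).
  have e2 := IdS_word2 F0 fA (fun i k d l => part z _ i k d l pz (supportedN sy)).
  move: e2; rewrite (eq_lin_words _ (word2Nr c x y)).
  rewrite (eq_lin_words _ (word2Nl c y x)) (eq_lin_words _ (word2Nl c y _)).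
  rewrite !lin_wordsN (eq_lin_words _ (word2Nr c y y)) lin_wordsN opprK.
  rewrite !scaleNr -opprD => /eqP; rewrite subr_eq0 => /eqP e2.
  (* By [e2] the squares equal the mixed part, so [e1] says that twice the mixed part is zero. *)
  move: e1; rewrite e2 => /eqP; rewrite -mulr2n -scaler_nat scaler_eq0.
  by rewrite ((pcharf0P F).1 F0) => /eqP.
have /eqP := mixed 1 (gs_part1 A); rewrite mul1r mulr1 -scalerDl scaler_eq0.
case/orP=> [|/eqP/noncommuting_neq0 //].
rewrite addrC addr_eq0 => /eqP yx.
have /eqP := mixed u pu; rewrite yx scaleNr -scalerBr scaler_eq0.
by case/orP=> /eqP // xy; rewrite xy oppr0.
Qed.

Variables (B : gsAlgebra F G) (a b : B).
Hypotheses (aa : a * a = 0) (bb : b * b = 0).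
Hypotheses (aba : a * b * a = 0) (bab : b * a * b = 0).

(** The relations leave only the monomials [1], [a], [b], [ab], [ba]. The coordinates [z] and [t],
    already attached to products, enter only to first order. *)
Lemma prod_nilpotent c x y z t s :
  \prod_(v <- s) ((c v)%:A + x v *: a + y v *: b
                  + z v *: (a * b) + t v *: (b * a))
  = (word0 c s)%:A + word1 c x s *: a + word1 c y s *: b
    + (word1 c z s + word2 c x y s) *: (a * b)
    + (word1 c t s + word2 c y x s) *: (b * a).
Proof.
elim: s => [|v s IHs].
  by rewrite /word0 !big_nil /= !addr0 !scale0r !addr0 scale1r.
rewrite big_cons IHs /word0 big_cons -/(word0 c s) /=.
set S := (X in _ * X).
have aS : a * S = word0 c s *: a + word1 c y s *: (a * b).
  by rewrite !mulrDr mulr_algr -!scalerAr !mulrA aa aba mul0r !scaler0 !addr0.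
have bS : b * S = word0 c s *: b + word1 c x s *: (b * a).
  by rewrite !mulrDr mulr_algr -!scalerAr !mulrA bb bab mul0r !scaler0 !addr0.
have abS : a * b * S = word0 c s *: (a * b).
  by rewrite -mulrA bS mulrDr -!scalerAr mulrA aba scaler0 addr0.
have baS : b * a * S = word0 c s *: (b * a).
  by rewrite -mulrA aS mulrDr -!scalerAr mulrA bab scaler0 addr0.
rewrite !mulrDl mulr_algl -!scalerAl aS bS abS baS /S.
rewrite !scalerDr !scalerA !scalerDl !mulrDr !scalerDl.
(* The thirteen summands are grouped by the monomials [1], [a], [b], [ab], [ba]. *)
by rewrite [LHS](AC (3*2*2*2*2*1*1)
  (1*(2*8)*(3*10)*((4*12)*(5*9))*((6*13)*(7*11)))).
Qed.

(** Only the degree is recorded for [ab] and [ba]: in the triangular algebras the involution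
    exchanges them up to sign, so neither is symmetric or skew. *)
Hypothesis partB : forall k d (r : B), gs_part k d r ->
  exists c x y z t : F,
    [/\ r = c%:A + x *: a + y *: b + z *: (a * b) + t *: (b * a),
        c != 0 \/ x != 0 -> k = 1%g /\ d = true,
        y != 0 -> k = g /\ d = e
      & z != 0 \/ t != 0 -> k = g].

Lemma in_varS_nilpotent : in_varS B A.
Proof.
move=> f fA rho rhoP.
have /choice[co coP] : forall v : gvar G, exists k : F * F * F * F * F,
    let: (c, x, y, z, t) := k in
    [/\ rho v = c%:A + x *: a + y *: b + z *: (a * b) + t *: (b * a),
        c != 0 \/ x != 0 -> v.1.2 = 1%g /\ v.2 = true,
        y != 0 -> v.1.2 = g /\ v.2 = e
      & z != 0 \/ t != 0 -> v.1.2 = g].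
  move=> [[i k] d]; have [c [x [y [z [t h]]]]] := partB (rhoP i k d).
  by exists (c, x, y, z, t).
pose c v := (co v).1.1.1.1; pose x v := (co v).1.1.1.2.
pose y v := (co v).1.1.2; pose z v := (co v).1.2; pose t v := (co v).2.
have {}coP v : [/\ rho v = (c v)%:A + x v *: a + y v *: b
                            + z v *: (a * b) + t v *: (b * a),
    c v != 0 \/ x v != 0 -> v.1.2 = 1%g /\ v.2 = true,
    y v != 0 -> v.1.2 = g /\ v.2 = e & z v != 0 \/ t v != 0 -> v.1.2 = g].
  by have := coP v; rewrite /c /x /y /z /t; case: (co v) => [[[[]]]].
have sc : supported 1%g true c by move=> v ?; case: (coP v); auto.
have sx : supported 1%g true x by move=> v ?; case: (coP v); auto.
have sy : supported g e y by move=> v ?; case: (coP v); auto.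
(* Both parts of degree [g] are nonzero: one contains [w], the other [[u, w]]. *)
have w0 d : exists2 p : A, gs_part g d p & p <> 0.
  have [->|de] := eqVneq d e; first by exists w => //; apply: noncommuting_neq0.
  exists (u * w - w * u) => //; have := gs_part_comm pu pw.
  by move: de; case: d; case: e.
(* A family of degree [g] with both signs is split into its symmetric and skew halves, each killed
   by an element from [w0]. *)
have word1_deg r : (forall v, r v != 0 -> v.1.2 = g) ->
    lin_words (word1 c r) f = 0.
  move=> rg; have split_r v : r v
      = (if v.2 then r v else 0) + (if v.2 then 0 else r v).
    by case: v.2; rewrite ?addr0 ?add0r.
  have -> : r = fun v => (if v.2 then r v else 0) + (if v.2 then 0 else r v).
    by apply/funext.
  rewrite (eq_lin_words _ (word1D c _ _)) lin_wordsD.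
  have [p pp np] := w0 true; have [m pm nm] := w0 false.
  rewrite (IdS_word1_eq0 sc _ pp np fA); last first.
    by move=> v; case: ifP => [_ /rg|_]; rewrite ?eqxx.
  rewrite (IdS_word1_eq0 sc _ pm nm fA) ?addr0 //.
  by move=> v; case: ifP => [_|_ /rg]; rewrite ?eqxx.
have [K1 K2] := IdS_word2_eq0 sc sx sy fA.
rewrite gs_evalE.
under eq_bigr => m _.
  under eq_bigr => v _ do rewrite (let: And4 h _ _ _ := coP v in h).
  rewrite prod_nilpotent !scalerDr !scalerA; over.
have z0 := word1_deg z (fun v h => let: And4 _ _ _ i := coP v in i (or_introl h)).
have t0 := word1_deg t (fun v h => let: And4 _ _ _ i := coP v in i (or_intror h)).
rewrite !big_split /= -!scaler_suml.
rewrite -[X in X%:A]/(lin_words (word0 c) f) -!/(lin_words (word1 c _) f).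
rewrite -/(lin_words (fun s => word1 c z s + word2 c x y s) f).
rewrite -/(lin_words (fun s => word1 c t s + word2 c y x s) f).
rewrite !lin_wordsD z0 t0 K1 K2 !addr0 !scale0r !addr0.
rewrite (IdS_word0 (x := c) (y := c) (u := 0) (w := 0) F0 fA); last first.
  move=> i k d l; rewrite !scaler0 addr0 scaler0 addr0.
  exact: gs_part_supported sc (gs_part1 A).
(* The derivative along [a] is detected in [A] by the unit, and the one along [b] by an element from
   [w0]. *)
rewrite (IdS_word1_eq0 sc sx (gs_part1 A) _ fA); last by apply/eqP/oner_neq0.
have [p pp np] := w0 e.
by rewrite (IdS_word1_eq0 sc sy pp np fA) !scale0r !addr0.
Qed.

End Transfer.

(** * The multiplicity as a test on one commutator *)

Lemma commutator_shift (F : fieldType) (A : algType F) (p w : A) (k l : F) :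
  (p + k%:A) * (w + l%:A) - (w + l%:A) * (p + k%:A) = p * w - w * p.
Proof.
rewrite !mulrDl !mulrDr !mulr_algl !mulr_algr !scalerA (mulrC k).
rewrite [X in X - _]addrACA -[X in X - _]addrA -[X in _ - X]addrA.
by rewrite opprD addrACA subrr addr0.
Qed.

Lemma lin_span_pair (F : fieldType) (V : lmodType F) (S : set V) (x y v : V) :
  (forall b, S b -> b = x \/ b = y) -> lin_span S v ->
  exists k l : F, v = k *: x + l *: y.
Proof.
move=> Sxy [n [c [b [Sb ->]]]].
elim/big_ind: _ => [|_ _ [k1 [l1 ->]] [k2 [l2 ->]]|i _].
- by exists 0, 0; rewrite !scale0r addr0.
- by exists (k1 + k2), (l1 + l2); rewrite !scalerDl addrACA.
- case: (Sxy _ (Sb i)) => ->; first by exists (c i), 0; rewrite scale0r addr0.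
  by exists 0, (c i); rewrite scale0r add0r.
Qed.

Section Multiplicity.
Variables (F : fieldType) (G : finGroupType).

Section Eval.
Variables (A : gsAlgebra F G) (rho : gvar G -> A).

(** Named so that it can be registered as a monoid morphism, which yields the multiplicativity of
    [gs_eval]. *)
Definition word_eval (m : {fmonom gvar G}) : A := \prod_(v <- m) rho v.

Fact word_eval_is_multiplicative : mmorphism word_eval.
Proof.
split; last by rewrite /word_eval fm1 big_nil.
by move=> m1 m2; rewrite /word_eval fmM big_cat.
Qed.

HB.instance Definition _ := monalg.isMultiplicative.Build
  {fmonom gvar G} A word_eval word_eval_is_multiplicative.

Lemma gs_eval_mmap : gs_eval rho =1 mmap (in_alg A) word_eval.
Proof. by []. Qed.

Lemma gs_evalM p q : gs_eval rho (p * q) = gs_eval rho p * gs_eval rho q.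
Proof.
rewrite !gs_eval_mmap.
apply: (commr_mmap_is_multiplicative (f := in_alg A) (h := word_eval) _).1.
by move=> f m m'; rewrite /GRing.comm /= mulr_algl mulr_algr.
Qed.

Lemma gs_eval1 : gs_eval rho 1 = 1.
Proof. by rewrite gs_eval_mmap mmap1. Qed.

Lemma gs_evalZ k p : gs_eval rho (k *: p) = k *: gs_eval rho p.
Proof. by rewrite !gs_eval_mmap mmapZ /= mulr_algl. Qed.

Lemma gs_evalD p q : gs_eval rho (p + q) = gs_eval rho p + gs_eval rho q.
Proof. by rewrite !gs_eval_mmap mmapD. Qed.

Lemma gs_evalB p q : gs_eval rho (p - q) = gs_eval rho p - gs_eval rho q.
Proof. by rewrite !gs_eval_mmap mmapB. Qed.

Lemma gs_evalX v : gs_eval rho (Xv F v) = rho v.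
Proof.
by rewrite gs_eval_mmap mmapU /= /word_eval fmU big_seq1 scale1r mul1r.
Qed.

Lemma gs_evalXX v w : gs_eval rho (Xv F v * Xv F w) = rho v * rho w.
Proof. by rewrite gs_evalM; congr (_ * _); apply: gs_evalX. Qed.

Lemma gs_eval_comm p q : gs_eval rho (p * q - q * p)
  = gs_eval rho p * gs_eval rho q - gs_eval rho q * gs_eval rho p.
Proof. by rewrite gs_evalB; congr (_ - _); apply: gs_evalM. Qed.

Lemma gs_eval_sum (I : Type) (r : seq I) (f : I -> free_gs F G) :
  gs_eval rho (\sum_(i <- r) f i) = \sum_(i <- r) gs_eval rho (f i).
Proof. by rewrite gs_eval_mmap raddf_sum. Qed.

End Eval.

(** Variables outside commutators are not shifted, and commutators do not see scalars. *)
Lemma proper_poly_shift (A : gsAlgebra F G) (rho rho' : gvar G -> A) k p :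
  (forall v, rho' v = rho v + (k v)%:A) ->
  (forall v, ~~ is_var_1plus v -> k v = 0) ->
  proper_poly F G p -> gs_eval rho' p = gs_eval rho p.
Proof.
move=> rhoE k0 [n [c [b [hb ->]]]]; rewrite !gs_eval_sum; apply: eq_bigr => i _.
rewrite !gs_evalZ; congr (_ *: _).
have [fs [hfs ->]] := hb i; elim: fs hfs => [|f fs IHfs] hfs.
  by rewrite !big_nil !gs_eval1.
rewrite !big_cons !gs_evalM IHfs => [|f' f'fs]; last first.
  by apply: hfs; rewrite inE f'fs orbT.
congr (_ * _); have [[v [nv ->]]|[v [w [vs ->]]]] := hfs f (mem_head _ _).
  by rewrite !gs_evalX rhoE k0 // scale0r addr0.
have commE p1 l w1 : gs_eval rho' p1 = gs_eval rho p1 + l%:A ->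
    gs_eval rho' (p1 * Xv F w1 - Xv F w1 * p1)
    = gs_eval rho (p1 * Xv F w1 - Xv F w1 * p1).
  move=> p1E; rewrite !gs_eval_comm (gs_evalX rho') (gs_evalX rho) p1E rhoE.
  exact: commutator_shift.
(* The innermost commutator absorbs the shifts of its two entries; afterwards only the newly
   bracketed variable is shifted. *)
have foldE p1 : gs_eval rho' p1 = gs_eval rho p1 ->
    gs_eval rho' (foldl (fun p w => p * Xv F w - Xv F w * p) p1 vs)
    = gs_eval rho (foldl (fun p w => p * Xv F w - Xv F w * p) p1 vs).
  elim: vs p1 => //= w1 vs IHvs p1 p1E; apply: IHvs.
  by apply: (commE _ 0); rewrite p1E scale0r addr0.
by apply: foldE; apply: (commE _ (k v)); rewrite !gs_evalX rhoE.
Qed.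

Definition commX (v w : gvar G) : free_gs F G :=
  Xv F v * Xv F w - Xv F w * Xv F v.

Variables (A : gsAlgebra F G) (t : G) (e : bool).
Let v0 : gvar G := (0%N, 1%g, true).
Let v1 : gvar G := (1%N, t, e).

Lemma Gamma11_comm : Gamma11 F t e (commX v0 v1).
Proof.
split.
  exists 1%N, (fun=> 1), (fun=> commX v0 v1); split; last first.
    by rewrite big_ord1 scale1r.
  move=> _; exists [:: commX v0 v1]; split; last by rewrite big_seq1.
  by move=> f; rewrite inE => /eqP->; right; exists v0, v1, [::].
exists 2%N, (fun i => if i == ord0 then 1 else -1).
exists (fun i => if i == ord0 then Xv F v0 * Xv F v1 else Xv F v1 * Xv F v0).
split; last by rewrite big_ord_recl big_ord1 /= scale1r scaleN1r.
move=> i; case: ifP => _.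
  by exists [:: v0; v1]; rewrite big_cons big_seq1.
by exists [:: v1; v0]; rewrite (perm_catC [:: v1] [:: v0]) big_cons big_seq1.
Qed.

(** Multilinearity leaves two words, and invariance under scalar shifts of the first variable makes
    their coefficients opposite. *)
Lemma Gamma11E p : Gamma11 F t e p -> exists k : F, p = k *: commX v0 v1.
Proof.
move=> [pp multi].
have [|k [l pE']] := lin_span_pair (x := Xv F v0 * Xv F v1)
    (y := Xv F v1 * Xv F v0) _ multi.
  move=> _ [ws [ws_perm ->]].
  have : ws = [:: v0; v1] \/ ws = [:: v1; v0].
    have := perm_size ws_perm; case: ws ws_perm => [|x [|y []]] //= ws_perm _.
    have : x \in [:: v0; v1] by rewrite -(perm_mem ws_perm) mem_head.
    rewrite !inE => /orP[]/eqP xE; subst x.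
      by move: ws_perm; rewrite perm_cons => /perm_small_eq->; [left|].
    move: ws_perm; rewrite perm_sym (perm_catC [:: v0] [:: v1]) perm_sym.
    by rewrite perm_cons => /perm_small_eq->; [right|].
  by case=> ->; rewrite big_cons big_seq1; [left|right].
have evE (rho : gvar G -> A) :
    gs_eval rho p = k *: (rho v0 * rho v1) + l *: (rho v1 * rho v0).
  rewrite pE' gs_evalD; congr (_ + _); rewrite gs_evalZ; congr (_ *: _);
      exact: gs_evalXX.
exists k; suff lE : l = - k by rewrite pE' lE scaleNr -scalerBr.
(* Sending [v0] to [0] or to [1], and all else to [1], gives values [0] and [k + l]; the two
   evaluations differ by a shift of [v0]. *)
pose rho (v : gvar G) : A := (v != v0)%:R.
have /eqP : gs_eval (fun=> 1 : A) p = 0.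
  rewrite (@proper_poly_shift A rho (fun=> 1) (fun v => (v == v0)%:R) p) //.
  - by rewrite evE /rho eqxx mulr0 mul0r !scaler0 addr0.
  - by move=> v; rewrite /rho; case: eqP; rewrite ?scale0r ?scale1r ?addr0 ?add0r.
  - by move=> v; case: eqP => [->|//]; rewrite /is_var_1plus eqxx.
rewrite evE mulr1 -scalerDl scaler_eq0.
by rewrite oner_eq0 orbF addrC addr_eq0 => /eqP.
Qed.

(** [Gamma11] is spanned by the commutator, so the quotient has dimension 0 or 1. *)
Lemma mult11_neq0P : mult11 A t e <> 0%N <-> ~ IdS A (commX v0 v1).
Proof.
pose I := Gamma11 F t e `&` IdS A; split.
  move=> m0 cA; apply: m0; rewrite /mult11 /quo_dim -/I.
  (* The default value and dimension 0 are immediate; in dimension [d.+1] the first basis vector is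
     a multiple of an identity, against freeness. *)
  case: xgetP => // -[//|d] _ [b [Gb b_free _]].
  have /b_free/(_ ord0)/eqP : I (\sum_(i < d.+1) (i == ord0)%:R *: b i).
    rewrite big_ord_recl eqxx scale1r big1 ?addr0 => [|i _]; last first.
      by rewrite scale0r.
    split=> // rho rhoP; have [k ->] := Gamma11E (Gb ord0).
    by rewrite gs_evalZ cA ?scaler0.
  by rewrite eqxx oner_eq0.
move=> cA; have I0 : I 0.
  split; last by move=> rho _; rewrite -[0](scale0r 0) gs_evalZ scale0r.
  by split; exists 0%N, (fun=> 0), (fun=> 0); rewrite big_ord0; split=> // -[].
(* Exhibiting a dimension rules out the default value [0] of [quo_dim]. *)
have dim1 : has_quo_dim (Gamma11 F t e) I 1.
  exists (fun=> commX v0 v1); split=> [_|c|p /Gamma11E[k ->]].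
  - exact: Gamma11_comm.
  - rewrite big_ord1 => -[_ Ic] i; rewrite ord1.
    apply: contrapT => /eqP c0; apply: cA => rho rhoP.
    by have /eqP := Ic rho rhoP; rewrite gs_evalZ scaler_eq0 (negPf c0) => /eqP.
  - by exists (fun=> k); rewrite big_ord1 subrr.
rewrite /mult11 /quo_dim -/I; case: xgetP => [d _ [b [_ _ spanb]] d0|no].
  subst d; have [c] := spanb _ Gamma11_comm; rewrite big_ord0 subr0.
  by case=> _ /cA.
by case: (no 1%N).
Qed.

End Multiplicity.

(** * The triangular algebras as nilpotent models *)

(* [e = true] gives U_3 and [e = false] gives N_3. *)
Section TriangularAlgebras.
Variables (F : fieldType) (G : finGroupType) (A : gsAlgebra F G) (g : G).
Hypothesis F0 : [pchar F] =i pred0.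
Variable e : bool.
Let s : F := if e then 1 else -1.
Let ma : 'M[F]_6 := e6 F 2 3 + e6 F 4 5.
(** The reflection exchanges [e_12] and [e_56], so the sign [s] makes [mb] symmetric or skew. *)
Let mb : 'M[F]_6 := e6 F 1 2 + s *: e6 F 5 6.

(** Generators, degrees and closure properties stay abstract so that one argument covers both
    [U3_gs] and [N3_gs]. *)
Variables (X : 5.-tuple 'M[F]_6) (d : 'I_5 -> G) (T : {aspace 'M[F]_6}).
Hypothesis spanT : (T : {vspace 'M[F]_6}) = <<X>>%VS.
Hypothesis homX : forall k, elem_homog (gs6 g) (d k) X`_k.
Hypothesis homrX : forall k, elem_homog (gs6 g) (d k) (reflect_mx X`_k).
Hypothesis rX : forall k : 'I_5, reflect_mx X`_k \in T.
Hypothesis XE : tval X = [:: 1; ma; mb; e6 F 1 3; e6 F 4 6].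

Let B : gsAlgebra F G := er_gsAlgebra spanT homX homrX rX.

Let memX M : M \in tval X -> M \in T.
Proof. by rewrite spanT; apply: memv_span. Qed.

Let ss : s * s = 1. Proof. by rewrite /s; case: e; rewrite ?mulrNN mulr1. Qed.

Let maa : ma * ma = 0.
Proof. by rewrite mulrDl !mulrDr !e6M //= !scale0r !addr0. Qed.

Let mbb : mb * mb = 0.
Proof.
by rewrite mulrDl !mulrDr -!scalerAl -!scalerAr !e6M //= !scale0r !scaler0 !addr0.
Qed.

Let mab : ma * mb = s *: e6 F 4 6.
Proof.
rewrite mulrDl !mulrDr -!scalerAr !e6M //= !scale0r !scaler0 !addr0 !add0r.
by rewrite scale1r.
Qed.

Let mba : mb * ma = e6 F 1 3.
Proof.
rewrite mulrDl !mulrDr -!scalerAl !e6M //= !scale0r !scaler0 !addr0.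
by rewrite scale1r.
Qed.

Let maba : ma * mb * ma = 0.
Proof. by rewrite mab -scalerAl mulrDr !e6M //= !scale0r addr0 scaler0. Qed.

Let mbab : mb * ma * mb = 0.
Proof. by rewrite mba mulrDr -scalerAr !e6M //= !scale0r scaler0 addr0. Qed.

Let one_T : 1 \in T. Proof. by rewrite memX // XE mem_head. Qed.
Let ma_T : ma \in T. Proof. by rewrite memX // XE !inE eqxx orbT. Qed.
Let mb_T : mb \in T. Proof. by rewrite memX // XE !inE eqxx !orbT. Qed.

Let a : B := Subvs ma_T.
Let b : B := Subvs mb_T.

Let vsval_one : vsval (1 : subvs_of T) = 1.
Proof. by apply/eqP; rewrite /= algid_eq1. Qed.

Let opp_eq0 (k : F) : k = - k -> k = 0.
Proof.
move=> /eqP; rewrite -addr_eq0 -mulr2n -mulr_natr mulf_eq0 ((pcharf0P F).1 F0).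
by rewrite orbF => /eqP.
Qed.

Let i_ (k : nat) (lt_k6 : (k < 6)%N) : 'I_6 := Ordinal lt_k6.

Let memTE (M : 'M[F]_6) : M \in T -> exists c x y z t : F,
  M = c%:A + x *: ma + y *: mb + z *: e6 F 4 6 + t *: e6 F 1 3.
Proof.
rewrite spanT => /coord_span ->.
rewrite 4!big_ord_recl big_ord1 XE /= !addrA addrAC.
by do 5!eexists.
Qed.

Let partB k dl (r : B) : gs_part k dl r -> exists c x y z t : F,
  [/\ r = c%:A + x *: a + y *: b + z *: (a * b) + t *: (b * a),
      c != 0 \/ x != 0 -> k = 1%g /\ dl = true,
      y != 0 -> k = g /\ dl = e & z != 0 \/ t != 0 -> k = g].
Proof.
move=> [hom star]; have [c [x [y [z [t rE]]]]] := memTE (subvsP r).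
(* Indices start at 0. Each of [c], [x], [y] is read at two positions exchanged by the reflection;
   comparing them decides the sign. *)
have [[e00 e55] [e12 e34] [e01 e45] [e35 e02]] :
    let E n m n6 m6 := vsval r (@i_ n n6) (@i_ m m6) in
    [/\ E 0 0 isT isT = c /\ E 5 5 isT isT = c,
        E 1 2 isT isT = x /\ E 3 4 isT isT = x,
        E 0 1 isT isT = y /\ E 4 5 isT isT = y * s
      & E 3 5 isT isT = z /\ E 0 2 isT isT = t].
  by split; split; rewrite rE !mxE /= !(mulr0, mulr1, addr0, add0r).
have refl i j : vsval r (rev_ord j) (rev_ord i)
    = (if dl then 1 else -1) * vsval r i j.
  have : vsval (er_star r) = vsval (if dl then r else - r) by rewrite -star.
  rewrite (vsval_er_star spanT rX) => /matrixP/(_ i j).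
  rewrite mxE => ->; case: dl {star}; rewrite ?mul1r //=.
  by rewrite mulN1r mxE.
have rev n n' (h : (n < 6)%N) (h' : (n' < 6)%N) : (n + n' = 5)%N ->
    rev_ord (i_ h) = i_ h'.
  by move=> kk; apply: val_inj; rewrite /= -kk subSS addnC addnK.
have rc := refl (@i_ 0 isT) (@i_ 0 isT).
have rx := refl (@i_ 1 isT) (@i_ 2 isT).
have ry := refl (@i_ 0 isT) (@i_ 1 isT).
rewrite !(rev 0%N 5%N isT isT erefl) e00 e55 in rc.
rewrite (rev 1%N 4%N isT isT erefl) (rev 2%N 3%N isT isT erefl) e12 e34 in rx.
rewrite (rev 0%N 5%N isT isT erefl) (rev 1%N 4%N isT isT erefl) e01 e45 in ry.
have deg i j : vsval r i j != 0 -> k = ((gs6 g i)^-1 * gs6 g j)%g.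
  by move=> /hom <-.
have gs6E n (h : (n < 6)%N) : gs6 g (i_ h) = nth 1%g [:: 1; g; g; 1; 1; g]%g n.
  by rewrite /gs6 (tnth_nth 1%g).
have sym (p : F) : p = (if dl then 1 else -1) * p -> p != 0 -> dl = true.
  case: dl {star refl rc rx ry} => //; rewrite mulN1r => /opp_eq0->.
  by rewrite eqxx.
(* Since [ma * mb = s *: e_46] and [s * s = 1], the coordinate along [ab] is [s * z]. *)
exists c, x, y, (s * z), t; split.
- apply: val_inj; apply: etrans rE _.
  change (c%:A + x *: ma + y *: mb + z *: e6 F 4 6 + t *: e6 F 1 3
    = c *: vsval (1 : subvs_of T) + x *: ma + y *: mb
      + (s * z) *: (ma * mb) + t *: (mb * ma)).
  by rewrite vsval_one mab mba scalerA mulrAC ss mul1r.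
- case=> [c0|x0]; split.
  + by rewrite (deg (@i_ 0 isT) (@i_ 0 isT)) ?e00 // mulVg.
  + exact: sym rc c0.
  + by rewrite (deg (@i_ 1 isT) (@i_ 2 isT)) ?e12 // !gs6E mulVg.
  + exact: sym rx x0.
- move=> y0; split.
    by rewrite (deg (@i_ 0 isT) (@i_ 1 isT)) ?e01 // !gs6E /= invg1 mul1g.
  (* If [dl] differs from [e], the reflection forces [y = - y]. *)
  move: ry y0; rewrite /s; case: dl {star refl rc rx sym}; case: (e) => //.
    by rewrite mulrN1 mul1r => /esym/opp_eq0->; rewrite eqxx.
  by rewrite mulN1r mulr1 => /opp_eq0->; rewrite eqxx.
case=> [sz0|t0].
  rewrite (deg (@i_ 3 isT) (@i_ 5 isT)) ?gs6E /= ?invg1 ?mul1g //.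
  by rewrite e35; apply: contraNneq sz0 => ->; rewrite mulr0.
by rewrite (deg (@i_ 0 isT) (@i_ 2 isT)) ?e02 // !gs6E /= invg1 mul1g.
Qed.

Lemma mult11_triangular : mult11 A g e <> 0%N <-> in_varS B A.
Proof.
rewrite mult11_neq0P; split.
  (* An evaluation on which the commutator survives provides the noncommuting [u] and [w]. *)
  move=> cA; have [rho [rhoP nc]] : exists rho : gvar G -> A,
      (forall i k dl, gs_part k dl (rho (i, k, dl))) /\
      gs_eval rho (commX F (0%N, 1%g, true) (1%N, g, e)) <> 0.
    apply: contrapT => no; apply: cA => rho rhoP; apply: contrapT => nc.
    by apply: no; exists rho.
  have pu := rhoP 0%N 1%g true; have pw := rhoP 1%N g e.
  apply: (in_varS_nilpotent F0 pu pw _ (a := a) (b := b)) => //.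
  - by move: nc; rewrite /commX gs_eval_comm !gs_evalX.
  - exact: val_inj.
  - exact: val_inj.
  - exact: val_inj.
  - exact: val_inj.
move=> BA cA.
(* Conversely, [a] and [b] themselves witness that the commutator is not an identity of [B]. *)
pose rho (v : gvar G) : B :=
  if v == (0%N, 1%g, true) then a else if v == (1%N, g, e) then b else 0.
have rhoP i k dl : gs_part k dl (rho (i, k, dl)).
  rewrite /rho; case: eqP => [[_ -> ->]|_]; last case: eqP => [[_ -> ->]|_].
  - split.
      apply: elem_homogD; have [h23 h45 _ _ _] := gs6_homog F g; assumption.
    apply: val_inj; apply: etrans (vsval_er_star spanT rX _) _.
    by rewrite reflectD !reflect_e6 //= addrC.
  - split.
      have [_ _ h12 h56 _] := gs6_homog F g.
      by rewrite /= /er_comp /= /mb addrC; apply: elem_homog_comb.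
    apply: val_inj; apply: etrans (vsval_er_star spanT rX _) _.
    rewrite reflectD reflect_e6 // -[s *: _]addr0 reflect_mx_linear reflect_mx0.
    rewrite addr0 reflect_e6 //= addrC.
    transitivity (if e then mb else - mb); last by case: (e).
    rewrite /mb /s; case: (e); rewrite ?scale1r // !scaleN1r.
    by rewrite opprB addrC.
  - exact: gs_part0.
have := BA _ cA rho rhoP; rewrite /commX gs_eval_comm !gs_evalX /rho eqxx.
rewrite (_ : ((1%N, g, e) == (0%N, 1%g, true)) = false); last exact/eqP.
rewrite eqxx => ab0.
have : vsval (a * b - b * a) = 0 by rewrite ab0.
change (vsval (a * b - b * a)) with (ma * mb - mb * ma).
(* This position is that of [e_13], where [ab - ba = s e_46 - e_13] has entry [-1]. *)
rewrite mab mba => /matrixP/(_ (@i_ 0 isT) (@i_ 2 isT)); rewrite !mxE /=.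
by rewrite mulr0 add0r => /eqP; rewrite oppr_eq0 oner_eq0.
Qed.

End TriangularAlgebras.

Theorem lemma4p4 (R : realType) (F : fieldType) (G : finGroupType)
    (A : gsAlgebra F G) :
  ([pchar F] =i pred0)%R ->
  quadratic_growth R (codimS A) ->
  of_type_FJ A ->
  (forall h : G, h <> 1%g ->
     mult11 A h true <> 0%N <-> in_varS (U3_gs F h) A) /\
  (forall g : G,
     mult11 A g false <> 0%N <-> in_varS (N3_gs F g) A).
Proof.
move=> F0 _ _; split=> [h _|g].
  (* The generators match the abstract ones with [s = 1] here and [s = -1] for [N3_gs]. *)
  by apply: mult11_triangular => //=; rewrite scale1r.
by apply: mult11_triangular => //=; rewrite scaleN1r.
Qed.
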